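(* Let $G_1$ and $G_2$ be finite simple graphs with $n_1 = |V(G_1)| \geq 2$, $n_2 = |V(G_2)| \geq 2$, $m_1 = |E(G_1)|$ and $m_2 = |E(G_2)|$. Then $$\tau(G_1 \square G_2) \leq \tau(G_1)\,\tau(G_2) \left[ \frac{2m_1}{n_1-1} + \frac{2m_2}{n_2-1} \right]^{(n_1-1)(n_2-1)},$$ and equality holds if and only if $G_1$ is not connected, or $G_2$ is not connected, or ($G_1 \cong K_{n_1}$ and $G_2 \cong K_{n_2}$).
   Context: For a graph $G$, $\tau(G)$ denotes the number of spanning trees of $G$ (so $\tau(G)=0$ if $G$ is not connected). $K_n$ is the complete graph on $n$ vertices. For simple graphs $G_1, G_2$, the Cartesian product $G_1 \square G_2$ is the graph with vertex set $V(G_1) \times V(G_2)$ in which $(u,u')$ and $(v,v')$ are adjacent if and only if either $u = v$ and $u'v' \in E(G_2)$, or $u' = v'$ and $uv \in E(G_1)$. *)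

(* Defs.v *)
From mathcomp Require Import all_boot.

Set Implicit Arguments.
Unset Strict Implicit.
Unset Printing Implicit Defensive.

Record sgraph := SGraph {
  svertex :> finType;
  sedge : rel svertex;
  sedge_sym : symmetric sedge;
  sedge_irrefl : irreflexive sedge
}.

Definition edges (G : sgraph) : {set {set G}} :=
  [set [set p.1; p.2] | p : G * G & sedge p.1 p.2].

Lemma in_edges (G : sgraph) (x y : G) : ([set x; y] \in edges G) = sedge x y.
Proof.
apply/imsetP/idP => [[[u v]]|exy]; last by exists (x, y) => //; rewrite inE.
rewrite inE /= => euv E.
have ux : u \in [set x; y] by rewrite E !inE eqxx.
have vx : v \in [set x; y] by rewrite E !inE eqxx orbT.
move: ux vx euv; rewrite !inE => /orP[]/eqP-> /orP[]/eqP->;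
  by rewrite ?sedge_irrefl // sedge_sym.
Qed.

Definition connected (G : sgraph) : bool :=
  [forall x : G, forall y : G, connect (@sedge G) x y].

(* A cycle is a duplicate-free cyclic sequence of at least three vertices; the
   length bound #|G| makes the quantification finite and loses nothing, see
   [acyclicP]. *)
Definition acyclic (G : sgraph) : bool :=
  [forall k : 'I_#|G|.+1, forall s : k.-tuple G,
     (2 < k) ==> ~~ ucycleb (@sedge G) s].

Lemma acyclicP (G : sgraph) :
  reflect (forall s : seq G, 2 < size s -> ~ ucycle (@sedge G) s) (acyclic G).
Proof.
apply: (iffP forallP) => [H s s2 us|H k]; last first.
  apply/forallP => s; apply/implyP => k2; apply/negP; apply: H.
  by rewrite size_tuple.
have sk : size s < #|G|.+1.
  by case/andP: (us) => _ /card_uniqP <-; rewrite ltnS max_card.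
have /forallP/(_ (in_tuple s)) := H (Ordinal sk).
by move=> /implyP/(_ s2)/negP; apply.
Qed.

Definition is_tree (G : sgraph) : bool := connected G && acyclic G.

Section SpanningSubgraph.
Variables (V : finType) (F : {set {set V}}).

Definition span_rel : rel V := [rel x y | (x != y) && ([set x; y] \in F)].

Fact span_rel_sym : symmetric span_rel.
Proof. by move=> x y; rewrite /span_rel /= eq_sym setUC. Qed.

Fact span_rel_irrefl : irreflexive span_rel.
Proof. by move=> x; rewrite /span_rel /= eqxx. Qed.

Definition span_graph : sgraph := SGraph span_rel_sym span_rel_irrefl.

End SpanningSubgraph.

(* A spanning tree is identified with its edge set. *)
Definition spanning_trees (G : sgraph) : {set {set {set G}}} :=
  [set F : {set {set G}} | (F \subset edges G) && is_tree (span_graph F)].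

Definition tau (G : sgraph) : nat := #|spanning_trees G|.

Section Complete.
Variable n : nat.

Definition complete_rel : rel 'I_n := [rel x y | x != y].

Fact complete_rel_sym : symmetric complete_rel.
Proof. by move=> x y; rewrite /complete_rel /= eq_sym. Qed.

Fact complete_rel_irrefl : irreflexive complete_rel.
Proof. by move=> x; rewrite /complete_rel /= eqxx. Qed.

Definition complete_graph : sgraph :=
  SGraph complete_rel_sym complete_rel_irrefl.

End Complete.

Section CartesianProduct.
Variables G1 G2 : sgraph.

Definition cart_rel : rel (G1 * G2) :=
  [rel u v | ((u.1 == v.1) && sedge u.2 v.2)
             || ((u.2 == v.2) && sedge u.1 v.1)].

Fact cart_rel_sym : symmetric cart_rel.
Proof.
by move=> u v; rewrite /cart_rel /= (eq_sym u.1) (eq_sym u.2) (sedge_sym u.1)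
  (sedge_sym u.2). Qed.

Fact cart_rel_irrefl : irreflexive cart_rel.
Proof. by move=> u; rewrite /cart_rel /= !sedge_irrefl !andbF. Qed.

Definition cart_prod : sgraph := SGraph cart_rel_sym cart_rel_irrefl.

End CartesianProduct.

Definition sg_iso (G H : sgraph) : Prop :=
  exists2 f : G -> H, bijective f & forall x y, sedge (f x) (f y) = sedge x y.

(* Main.v *)
Require Import Defs.
From mathcomp Require Import all_boot all_order all_fingroup all_algebra.
From mathcomp Require Import all_field mxtens.

Set Implicit Arguments.
Unset Strict Implicit.
Unset Printing Implicit Defensive.

Import Order.TTheory GRing.Theory Num.Theory.

(** Let [l] and [k] be the Laplacian eigenvalues of [G1] and [G2] other than the
    eigenvalue [0] of the constant vector. By the matrix-tree theorem
    [n1 * tau G1] and [n2 * tau G2] are the products of the [l_i] and of the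
    [k_j]. The Laplacian of the Cartesian product is [L1 (x) 1 + 1 (x) L2], with
    eigenvalues [l_i + k_j], so [tau (G1 [] G2)] is [tau G1 * tau G2] times the
    product of all [l_i + k_j]. The bound is AM-GM for these numbers, whose sum
    is read off the traces of [L1] and [L2]. Equality forces all [l_i] and all
    [k_j] to be equal, so that each Laplacian is a combination of the identity
    and the all-ones matrix.

    The matrix-tree theorem is obtained by expanding a principal cofactor of the
    Laplacian row by row: only the functions all of whose orbits reach the root
    contribute, and those sending every other vertex to a neighbour are in
    bijection with the spanning trees. *)

(** * Spanning trees as parent functions *)

Lemma eq_set2 (T : finType) (a b c d : T) : [set a; b] = [set c; d] ->
  (a = c /\ b = d) \/ (a = d /\ b = c).
Proof.
move=> E; have := set22 a b; have := set21 a b.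
rewrite {1 2}E => /set2P ac /set2P bc; have := set22 c d; have := set21 c d.
rewrite -E => /set2P ca /set2P cb.
by case: ac bc ca cb => ? [] ? [] ? [] ?; subst; by [left|right].
Qed.

Lemma connect_rank (V : finType) (e : rel V) (r : V) :
    (forall v, connect e v r) ->
  exists d : V -> nat, forall v, v != r -> exists2 u, e v u & d u < d v.
Proof.
move=> conn.
pose reach v k := [exists p : k.-tuple V, path e v p && (last v p == r)].
have reachable v : exists k, reach v k.
  have /connectP[p ep lp] := conn v; exists (size p).
  by apply/existsP; exists (in_tuple p); rewrite ep -lp /=.
exists (fun v => ex_minn (reachable v)) => v vr.
case: ex_minnP => k /existsP[[[|u p] /= /eqP <-]].
  by rewrite (negPf vr).
case/andP=> /andP[evu ep] lp _; exists u => //; case: ex_minnP => m _; apply.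
by apply/existsP; exists (in_tuple p); rewrite ep.
Qed.

Lemma rank_fconnect (V : finType) (f : V -> V) (r : V) (d : V -> nat) :
  (forall v, v != r -> d (f v) < d v) -> forall v, fconnect f v r.
Proof.
move=> dP v; have [m] := ubnP (d v); elim: m v => // m IHm v dv.
have [->|/dP fv] := eqVneq v r; first exact: connect0.
exact: connect_trans (fconnect1 f v) (IHm _ (leq_trans fv dv)).
Qed.

Lemma ucycle_two_neighbors (T : eqType) (e : rel T) (s : seq T) (x : T) :
    symmetric e -> ucycle e s -> 2 < size s -> x \in s ->
  exists y z, [/\ y \in s, z \in s, y != z, e x y & e x z].
Proof.
move=> e_sym /andP[es us] s_gt2 /rot_to[i [|y t] rot_s].
  by rewrite -(size_rot i) rot_s in s_gt2.
case/lastP: t rot_s => [|t z] rot_s.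
  by rewrite -(size_rot i) rot_s in s_gt2.
move: es us; rewrite -(rot_cycle i) -(rot_uniq i) rot_s /= rcons_path.
rewrite last_rcons => /and3P[xy _ zx] /and3P[_ + _].
rewrite mem_rcons inE negb_or => /andP[yz _].
exists y, z; rewrite -!(mem_rot i s) rot_s (e_sym x z) zx xy yz.
by rewrite !(inE, mem_rcons) !eqxx !orbT.
Qed.

(* In a cycle, a vertex of maximal rank has two neighbours of no larger rank. *)
Lemma acyclic_rank (G : sgraph) (d : G -> nat) :
    (forall x y z, sedge x y -> sedge x z ->
       d y <= d x -> d z <= d x -> y = z) ->
  acyclic G.
Proof.
move=> dP; apply/acyclicP=> -[//|x0 s] s_gt2 cs.
case: (@arg_maxnP _ x0 [in x0 :: s] d (mem_head _ _)) => x xs x_max.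
have [y [z [ys zs yz exy exz]]] :=
  ucycle_two_neighbors (@sedge_sym G) cs s_gt2 xs.
by case/eqP: yz; apply: dP exy exz (x_max y ys) (x_max z zs).
Qed.

Section RootedFunctions.
Variables (V : finType) (r : V).
Implicit Types f g : {ffun V -> V}.

Definition rooted f := (f r == r) && [forall v, fconnect f v r].

Lemma rooted_rank f : rooted f ->
  exists d : V -> nat, forall v, v != r -> d (f v) < d v.
Proof.
case/andP=> _ /forallP/connect_rank[d dP].
by exists d => v /dP[u /eqP <-].
Qed.

Definition parent_edges f : {set {set V}} := [set [set v; f v] | v in [set~ r]].

Lemma in_parent_edges f x y : ([set x; y] \in parent_edges f) =
  (x != r) && (f x == y) || (y != r) && (f y == x).
Proof.
apply/imsetP/orP => [[v] | [] /andP[xr /eqP <-]].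
- by rewrite !inE => vr /eq_set2[] [-> ->]; rewrite vr eqxx; [left|right].
- by exists x; rewrite ?inE.
- by exists y; rewrite ?inE // setUC.
Qed.

Lemma parent_edges_connected f :
  rooted f -> connected (span_graph (parent_edges f)).
Proof.
case/andP=> /eqP fr /forallP fc.
have to_root x : connect (span_rel (parent_edges f)) x r.
  rewrite -(iter_findex (fc x)); elim: (findex f x r) => [|k IHk] /=.
    exact: connect0.
  apply: connect_trans IHk _; set y := iter k f x.
  have [fy|yf] := eqVneq y (f y); first by rewrite -fy connect0.
  apply: connect1; rewrite /span_rel /= yf in_parent_edges eqxx andbT.
  by have [yr|//] := eqVneq y r; rewrite yr fr eqxx in yf.
apply/forallP=> x; apply/forallP=> y; apply: connect_trans (to_root x) _.
by rewrite (sym_connect_sym (@span_rel_sym _ _)).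
Qed.

Lemma parent_edges_acyclic f :
  rooted f -> acyclic (span_graph (parent_edges f)).
Proof.
case/rooted_rank=> d dP; apply: (@acyclic_rank (span_graph _) d).
have parent x y : span_rel (parent_edges f) x y -> d y <= d x -> f x = y.
  case/andP=> _; rewrite in_parent_edges => /orP[/andP[_ /eqP //]|].
  by case/andP=> yr /eqP fy; rewrite leqNgt -fy dP.
by move=> x y z exy exz yx zx; rewrite -(parent x y) // (parent x z).
Qed.

Lemma parent_edges_inj : {in rooted &, injective parent_edges}.
Proof.
move=> f g rf rg Efg; have [/andP[/eqP fr _] /andP[/eqP gr _]] := (rf, rg).
have [d dP] := rooted_rank rf; apply/ffunP=> v.
have [m] := ubnP (d v); elim: m v => // m IHm v dv.
have [->|vr] := eqVneq v r; first by rewrite fr gr.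
have : [set v; f v] \in parent_edges g by rewrite -Efg in_parent_edges vr eqxx.
rewrite in_parent_edges => /orP[/andP[_ /eqP //]|/andP[fvr /eqP gfv]].
have ffv : f (f v) = v by rewrite IHm ?gfv // (leq_trans (dP v vr)).
by have := dP _ fvr; rewrite ffv ltnNge ltnW // dP.
Qed.

Variable e : rel V.

Definition arborescence f := rooted f && [forall (v | v != r), e v (f v)].

Lemma exists_arborescence : (forall v, connect e v r) ->
  exists f, arborescence f.
Proof.
case/connect_rank=> d dP.
pose f := [ffun v => if v == r then r else
             odflt v [pick u | e v u && (d u < d v)]].
have fP v : v != r -> e v (f v) && (d (f v) < d v).
  move=> vr; rewrite ffunE (negPf vr); case: pickP => // none.
  by have [u evu du] := dP v vr; have := none u; rewrite evu du.
exists f; apply/andP; split; last by apply/forall_inP=> v /fP/andP[].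
rewrite /rooted ffunE !eqxx; apply/forallP/(@rank_fconnect _ _ _ d).
by move=> v /fP/andP[].
Qed.

End RootedFunctions.

(* An edge outside a connected spanning subgraph would close a cycle. *)
Lemma acyclic_connected_sub (V : finType) (F F' : {set {set V}}) (x y : V) :
    acyclic (span_graph F) -> connected (span_graph F') -> F' \subset F ->
  x != y -> [set x; y] \in F -> [set x; y] \in F'.
Proof.
move=> /acyclicP Fa /forallP F'c F'F xy xyF; apply: contraT => xyNF'.
have /connectP[_ /shortenP[p pe pu _] py] : connect (span_rel F') x y.
  exact: (forallP (F'c x)).
have FF' : subrel (span_rel F') (span_rel F).
  by move=> a b /andP[ab abF']; rewrite /span_rel /= ab (subsetP F'F).
case: (Fa (x :: p)); last first.
  rewrite /ucycle /ucycleb pu andbT /= rcons_path (sub_path FF' pe) -py.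
  by rewrite /span_rel /= eq_sym xy setUC.
case: p pe pu py => [_ _ /= yx|z [|//]] /=; first by rewrite yx eqxx in xy.
by rewrite andbT => /andP[_ xzF'] _ yz; rewrite yz xzF' in xyNF'.
Qed.

Section SpanningTrees.
Variables (G : sgraph) (r : G).
Implicit Type f : {ffun G -> G}.

Lemma parent_edges_spanning_tree f : arborescence r (@sedge G) f ->
  parent_edges r f \in spanning_trees G.
Proof.
case/andP=> rf /forall_inP fe; rewrite inE /is_tree.
rewrite parent_edges_connected // parent_edges_acyclic // !andbT.
by apply/subsetP=> _ /imsetP[v /[!inE] /fe evf ->]; rewrite in_edges.
Qed.

Lemma spanning_tree_parent (F : {set {set G}}) : F \in spanning_trees G ->
  exists2 f, arborescence r (@sedge G) f & F = parent_edges r f.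
Proof.
rewrite inE => /andP[/subsetP FG /andP[/forallP Fc Fa]].
have [v|f /andP[rf /forall_inP fF]] := @exists_arborescence _ r (span_rel F).
  exact: (forallP (Fc v)).
exists f.
  rewrite /arborescence rf; apply/forall_inP=> v /fF /andP[_ /FG].
  by rewrite in_edges.
have subF : parent_edges r f \subset F.
  by apply/subsetP=> _ /imsetP[v /[!inE] /fF /andP[_ vF] ->].
apply/eqP; rewrite eqEsubset subF andbT; apply/subsetP=> E EF.
have /imsetP[[x y] /[!inE] /= exy EE] := FG _ EF; rewrite {E}EE in EF *.
apply: acyclic_connected_sub Fa (parent_edges_connected rf) subF _ EF.
by apply: contraTneq exy => ->; rewrite sedge_irrefl.
Qed.

Lemma tau_arborescence : tau G = #|[pred f | arborescence r (@sedge G) f]|.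
Proof.
rewrite /tau -(card_in_imset (f := parent_edges r)); last first.
  by move=> f g /andP[rf _] /andP[rg _]; apply: parent_edges_inj.
apply: eq_card => F; apply/idP/imsetP => [/spanning_tree_parent[f arb ->]|].
  by exists f.
by case=> f arb ->; apply: parent_edges_spanning_tree.
Qed.

End SpanningTrees.

Lemma tau_gt0 (G : sgraph) : 0 < #|G| -> (0 < tau G) = connected G.
Proof.
case/card_gt0P=> r _; apply/idP/idP => [|Gc].
  case/card_gt0P=> F; rewrite inE => /andP[/subsetP FG /andP[/forallP Fc _]].
  apply/forallP=> x; apply/forallP=> y.
  have /forallP/(_ y) := Fc x; apply: connect_sub => a b /andP[_ /FG].
  by rewrite in_edges => /connect1.
have [v|f arb] := @exists_arborescence _ r (@sedge G).
  by have /forallP/(_ v)/forallP := Gc.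
by rewrite (tau_arborescence r); apply/card_gt0P; exists f.
Qed.

Lemma handshake (G : sgraph) :
  \sum_(x : G) \sum_(y : G) sedge x y = 2 * #|edges G|.
Proof.
transitivity (\sum_(p : G * G | sedge p.1 p.2) 1).
  by rewrite pair_bigA [RHS]big_mkcond /=; apply: eq_bigr => p _; case: sedge.
rewrite (partition_big (fun p => [set p.1; p.2]) (mem (edges G))); last first.
  by move=> p /= ep; rewrite in_edges.
rewrite -sum1_card big_distrr /=; apply: eq_bigr => _ /imsetP[[x y] /= exy ->].
rewrite inE /= in exy; rewrite sum1_card.
have xy : (x, y) != (y, x).
  by apply: contraTneq exy => -[-> _]; rewrite sedge_irrefl.
transitivity #|[set (x, y); (y, x)]|; last by rewrite cards2 xy.
apply: eq_card => -[a b]; rewrite !inE /=; apply/andP/orP.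
  by case=> _ /eqP/eq_set2[] /= [-> ->]; [left|right].
by case=> /eqP[-> ->]; rewrite ?(sedge_sym y) exy // setUC.
Qed.

(** * The matrix-tree theorem *)

Local Open Scope ring_scope.

Lemma sumr_deltal (R : pzSemiRingType) (I : finType) (i : I) (F : I -> R) :
  \sum_j (i == j)%:R * F j = F i.
Proof.
rewrite (bigD1 i) //= eqxx mul1r big1 ?addr0 // => j.
by rewrite eq_sym => /negPf ->; rewrite mul0r.
Qed.

Lemma sumr_deltar (R : pzSemiRingType) (I : finType) (i : I) (F : I -> R) :
  \sum_j F j * (i == j)%:R = F i.
Proof.
rewrite -[RHS]sumr_deltal; apply: eq_bigr => j _.
by rewrite mulr_natl mulr_natr.
Qed.

Lemma sumr_delta (R : pzSemiRingType) (I : finType) (i : I) :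
  \sum_j (i == j)%:R = 1 :> R.
Proof.
rewrite -[RHS](sumr_deltal i (fun=> 1)).
by apply: eq_bigr => j _; rewrite mulr1.
Qed.

Lemma prodr_natb (R : comNzSemiRingType) (I : finType) (P b : pred I) :
  \prod_(i | P i) (b i)%:R = [forall (i | P i), b i]%:R :> R.
Proof.
rewrite -big_andE; apply/esym.
by apply: (big_morph (fun c : bool => c%:R)) => // x y; rewrite -mulnb natrM.
Qed.

Lemma natr_tau (R : comNzSemiRingType) (G : sgraph) (r : G) :
  (tau G)%:R =
    \sum_(f | rooted r f) \prod_(v | v != r) (sedge v (f v))%:R :> R.
Proof.
rewrite (tau_arborescence r) -sum1_card natr_sum big_mkcondr /=.
by apply: eq_bigr => f _; rewrite prodr_natb; case: ifP.
Qed.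

Lemma reindex_rooted (R : comNzSemiRingType) (V W : finType) (h : V -> W)
    (r : V) (w : W -> W -> R) : bijective h ->
  \sum_(f | rooted (h r) f) \prod_(v | v != h r) w v (f v) =
  \sum_(f | rooted r f) \prod_(v | v != r) w (h v) (h (f v)).
Proof.
case=> h' hK h'K; have h_inj := can_inj hK.
pose lift_fun (f : {ffun V -> V}) : {ffun W -> W} := [ffun x => h (f (h' x))].
have lift_funE f v : lift_fun f (h v) = h (f v) by rewrite ffunE hK.
have iter_lift f k v : iter k (lift_fun f) (h v) = h (iter k f v).
  by elim: k => //= k ->; rewrite lift_funE.
have fconnect_lift f v u : fconnect (lift_fun f) (h v) (h u) = fconnect f v u.
  apply/idP/idP => /iter_findex.
    by rewrite iter_lift => /h_inj <-; apply: fconnect_iter.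
  by move<-; rewrite -iter_lift fconnect_iter.
have lift_bij : bijective lift_fun.
  exists (fun g : {ffun W -> W} => [ffun v => h' (g (h v))]) => f.
    by apply/ffunP=> v; rewrite !ffunE !hK.
  by apply/ffunP=> x; rewrite !ffunE !h'K.
rewrite (reindex lift_fun) /=; last exact: onW_bij.
apply: eq_big => [f|f _].
  rewrite /rooted lift_funE (inj_eq h_inj); congr (_ && _).
  apply/forallP/forallP=> [fc v|fc x]; first by rewrite -fconnect_lift.
  by rewrite -[x]h'K fconnect_lift.
rewrite (reindex h) /=; last by apply: onW_bij; exists h'.
apply: eq_big => [v|v _]; last by rewrite lift_funE.
by rewrite (inj_eq h_inj).
Qed.

Section Determinants.
Variable R : comNzRingType.

Lemma det_sum_rows (I : finType) n (B : 'I_n -> I -> 'I_n -> R) :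
  \det (\matrix_(i, j) \sum_k B i k j) =
  \sum_(f : {ffun 'I_n -> I}) \det (\matrix_(i, j) B i (f i) j).
Proof.
rewrite exchange_big /=; apply: eq_bigr => s _; rewrite -mulr_sumr.
congr (_ * _); under eq_bigr do rewrite mxE.
rewrite bigA_distr_bigA; apply: eq_bigr => f _.
by apply: eq_bigr => i _; rewrite mxE.
Qed.

Lemma det_scale_rows n (a : 'I_n -> R) (A : 'M[R]_n) :
  \det (\matrix_(i, j) (a i * A i j)) = \prod_i a i * \det A.
Proof.
have -> : \matrix_(i, j) (a i * A i j) = diag_mx (\row_i a i) *m A.
  by apply/matrixP=> i j; rewrite mul_diag_mx !mxE.
by rewrite det_mulmx det_diag; under eq_bigr do rewrite mxE.
Qed.

Lemma cofactorE_det n (A : 'M[R]_n) i0 j0 :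
  cofactor A i0 j0 =
    \det (\matrix_(i, j) if i == i0 then (j == j0)%:R else A i j).
Proof.
rewrite (expand_det_row _ i0) (bigD1 j0) //= !mxE !eqxx mul1r.
rewrite big1 ?addr0 => [|j /negPf jj0]; last by rewrite mxE eqxx jj0 mul0r.
rewrite !expand_cofactor; apply: eq_bigr => s _; congr (_ * _).
by apply: eq_bigr => i /negPf ii0; rewrite mxE eq_sym ii0.
Qed.

Lemma det_add1mxC m n (A : 'M[R]_(m, n)) (B : 'M[R]_(n, m)) :
  \det (1%:M + A *m B) = \det (1%:M + B *m A).
Proof.
pose U := block_mx 1%:M B 0 1%:M : 'M_(n + m).
pose M := block_mx 1%:M (- B) A 1%:M : 'M_(n + m).
have MU : M *m U = block_mx 1%:M 0 A (1%:M + A *m B).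
  by rewrite mulmx_block !(mulmx1, mul1mx, mulmx0, addr0) subrr addrC.
have UM : U *m M = block_mx (1%:M + B *m A) 0 A 1%:M.
  by rewrite mulmx_block !(mulmx1, mul1mx, mul0mx, add0r) addNr.
have := congr1 determinant MU; rewrite det_mulmx mulrC -det_mulmx UM.
by rewrite !det_lblock !det1 mul1r mulr1.
Qed.

Lemma det_add1_outer n (u : 'cV[R]_n) (v : 'rV[R]_n) :
  \det (1%:M + u *m v) = 1 + (v *m u) 0 0.
Proof. by rewrite det_add1mxC det_mx11 !mxE eqxx. Qed.

Lemma det0_kernel n (A : 'M[R]_n) (x : 'cV[R]_n) i :
  A *m x = 0 -> x i 0 = 1 -> \det A = 0.
Proof.
move=> Ax0 xi1; have := mulmxA (\adj A) A x.
rewrite Ax0 mulmx0 mul_adj_mx mul_scalar_mx => /colP/(_ i).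
by rewrite !mxE xi1 mulr1.
Qed.

Lemma perm_along_rooted (T : finType) (f : T -> T) (r : T) (s : {perm T}) :
    (forall v, fconnect f v r) ->
  (forall v, s v != v -> v != r /\ s v = f v) -> s = 1%g.
Proof.
move=> fc sf; apply/permP=> v; rewrite perm1; apply/eqP; apply: contraT => sv.
have moved k : s (iter k f v) != iter k f v.
  by elim: k => //= k IHk; have [_ <-] := sf _ IHk; rewrite (inj_eq perm_inj).
by have := moved (findex f v r); rewrite iter_findex // => /sf[]; rewrite eqxx.
Qed.

Definition functional_laplacian n (r : 'I_n) (f : 'I_n -> 'I_n) : 'M[R]_n :=
  \matrix_(i, j) ((i == j)%:R - (i != r)%:R * (f i == j)%:R).

(* The indicator of the points whose orbit avoids [r] is a kernel vector. *)
Lemma det_functional_laplacian0 n (r : 'I_n) (f : 'I_n -> 'I_n) v :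
  ~~ fconnect f v r -> \det (functional_laplacian r f) = 0.
Proof.
move=> vNr; apply: (@det0_kernel _ _ (\col_u (~~ fconnect f u r)%:R) v).
  apply/colP=> i; rewrite !mxE.
  under eq_bigr do rewrite !mxE mulrBl -mulrA.
  rewrite sumrB -mulr_sumr !sumr_deltal fconnect_eqVf.
  by case: (i == r); rewrite ?(mul0r, mul1r) ?subrr.
by rewrite mxE vNr.
Qed.

(* Only the identity contributes to the Leibniz expansion. *)
Lemma det_functional_laplacian1 n (r : 'I_n) (f : 'I_n -> 'I_n) :
  (forall v, fconnect f v r) -> \det (functional_laplacian r f) = 1.
Proof.
move=> fc; have f_nofix i : i != r -> (f i == i) = false.
  move=> ir; apply: contraNF ir => /eqP fi; rewrite -(iter_findex (fc i)).
  by elim: (findex _ _ _) => //= k /eqP <-; rewrite fi.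
rewrite /determinant (bigD1 1%g) //= odd_perm1 mul1r big1 => [|i _]; last first.
  rewrite mxE perm1 eqxx; have [_|/f_nofix ->] := eqVneq i r.
    by rewrite mul0r subr0.
  by rewrite mulr0 subr0.
rewrite big1 ?addr0 // => s; apply: contraNeq => /= prod_neq0.
apply/eqP/(perm_along_rooted fc) => v sv.
have : functional_laplacian r f v (s v) != 0.
  apply: contraNneq prod_neq0 => entry0.
  by rewrite (bigD1 v) //= entry0 mul0r mulr0.
have /negPf vs : v != s v by rewrite eq_sym.
rewrite mxE vs sub0r oppr_eq0 -natrM mulnb.
by case: (v != r); case: (f v =P s v); rewrite ?eqxx.
Qed.

Lemma det_functional_laplacian n (r : 'I_n) (f : 'I_n -> 'I_n) :
  \det (functional_laplacian r f) = [forall v, fconnect f v r]%:R.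
Proof.
case: forallP => [/det_functional_laplacian1 //|/forallP].
rewrite negb_forall => /existsP[v]; exact: det_functional_laplacian0.
Qed.

End Determinants.

Section WeightedLaplacian.
Variables (R : comNzRingType) (n : nat).
Implicit Types w A : 'M[R]_n.

Definition laplacian_mx w : 'M[R]_n :=
  \matrix_(i, j) ((i == j)%:R * (\sum_k w i k) - w i j).

Lemma laplacian_mx_tr w : w^T = w -> (laplacian_mx w)^T = laplacian_mx w.
Proof.
move=> w_sym; apply/matrixP=> i j; rewrite !mxE eq_sym.
have -> : w j i = w i j by rewrite -[in LHS]w_sym mxE.
by have [->|] := eqVneq i j; rewrite ?mul0r.
Qed.

Lemma mul_row_laplacian_mx w (x : 'rV_n) : w^T = w ->
  x *m laplacian_mx w = \row_j \sum_k w j k * (x 0 j - x 0 k).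
Proof.
move=> w_sym; apply/rowP=> j; rewrite -[in LHS](laplacian_mx_tr w_sym) !mxE.
under eq_bigr do rewrite !mxE mulrBr; under [RHS]eq_bigr do rewrite mulrBr.
rewrite !sumrB -mulr_suml; congr (_ - _).
  under eq_bigr do rewrite mulrCA.
  by rewrite sumr_deltal mulrC.
by apply: eq_bigr => k _; apply: mulrC.
Qed.

Lemma laplacian_mx_const m w a : laplacian_mx w *m const_mx a = 0 :> 'M_(n, m).
Proof.
apply/matrixP=> i j; rewrite !mxE; under eq_bigr do rewrite !mxE.
by rewrite -mulr_suml sumrB -mulr_suml sumr_delta mul1r subrr mul0r.
Qed.

Lemma const_laplacian_mx m w a : w^T = w ->
  const_mx a *m laplacian_mx w = 0 :> 'M_(m, n).
Proof.
move/laplacian_mx_tr=> L_sym; apply: trmx_inj.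
by rewrite trmx_mul L_sym trmx_const laplacian_mx_const trmx0.
Qed.

(* Row [i] of the Laplacian is the sum over [u] of [w i u] times [e_i - e_u], so
   expanding over one choice of [u] per row leaves a sum over functions. *)
Theorem weighted_matrix_tree w r : cofactor (laplacian_mx w) r r =
  \sum_(f | rooted r f) \prod_(v | v != r) w v (f v).
Proof.
pose c i u := if i == r then (r == u)%:R else w i u.
have grounded_rows : \matrix_(i, j) (if i == r then (j == r)%:R
      else laplacian_mx w i j) =
    \matrix_(i, j) \sum_u c i u * ((i == j)%:R - (i != r)%:R * (u == j)%:R).
  apply/matrixP=> i j; rewrite !mxE /c; have [->|ir] := eqVneq i r.
    by rewrite sumr_deltal mul0r subr0 eq_sym.
  under [RHS]eq_bigr => u _ do rewrite /= mul1r [u == j]eq_sym mulrBr.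
  by rewrite sumrB -mulr_suml sumr_deltar mulrC.
rewrite cofactorE_det grounded_rows det_sum_rows [RHS]big_mkcond /=.
apply: eq_bigr => f _.
transitivity (\prod_i c i (f i) * \det (functional_laplacian R r f)).
  rewrite -det_scale_rows; congr (\det _).
  by apply/matrixP=> i j; rewrite !mxE.
rewrite det_functional_laplacian (bigD1 r) //= /c eqxx /rooted [r == _]eq_sym.
under eq_bigr => i /negPf ir do rewrite ir.
by case: eqP => _; case: forallP => _; rewrite ?(mul1r, mulr1, mulr0, mul0r).
Qed.

(* With [d] the basis column at [r], [j] the all-ones column and [Ar] the matrix
   [A] with row [r] replaced by [d^T], three rank-one factors turn [Ar]
   successively into [A + d d^T], [A + j d^T] and [A + c j j^T]. *)
Lemma det_add_const_mx A c r :
    A *m const_mx 1 = 0 :> 'cV_n -> const_mx 1 *m A = 0 :> 'rV_n ->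
  \det (A + const_mx c) = c * n%:R ^+ 2 * cofactor A r r.
Proof.
move=> Aj jA.
pose j : 'cV[R]_n := const_mx 1; pose d : 'cV[R]_n := delta_mx r 0.
set Ar := \matrix_(i, k) (if i == r then (k == r)%:R else A i k).
have jT : j^T = const_mx 1 by rewrite trmx_const.
rewrite -/j in Aj; rewrite -jT in jA.
have jd : j^T *m d = 1%:M.
  by rewrite -colE jT; apply/matrixP=> a b; rewrite !mxE !ord1.
have dj : d^T *m j = 1%:M by rewrite -[j]trmxK -trmx_mul jd trmx1.
have dd : d^T *m d = 1%:M.
  by rewrite -colE trmx_delta; apply/matrixP=> a b; rewrite !mxE !ord1 !eqxx.
have jj : j^T *m j = n%:R%:M.
  apply/matrixP=> a b; rewrite !mxE !ord1 eqxx.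
  by under eq_bigr do rewrite !mxE mulr1; rewrite sumr_const card_ord.
have ArE : Ar = A + d *m (d^T - d^T *m A).
  rewrite trmx_delta -rowE; apply/matrixP=> a b; rewrite !mxE big_ord1 !mxE.
  have [->|_] := eqVneq a r; last by rewrite mul0r addr0.
  by rewrite mul1r addrC subrK.
have to_row : (1%:M + d *m (d^T - j^T)) *m Ar = A + d *m d^T.
  rewrite mulmxDl mul1mx -mulmxA ArE [(_ - _) *m _]mulmxDr mulmxA.
  rewrite [_ *m d]mulmxBl dd jd subrr mul0mx addr0 mulmxBl jA subr0.
  by rewrite -addrA -mulmxDr subrK.
have to_col : (1%:M + (j - d) *m j^T) *m (A + d *m d^T) = A + j *m d^T.
  rewrite mulmxDl mul1mx -mulmxA [j^T *m _]mulmxDr jA add0r [j^T *m _]mulmxA.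
  by rewrite jd mul1mx -addrA -mulmxDl subrKC.
have to_const :
    (A + j *m d^T) *m (1%:M + j *m (c *: j^T - d^T)) = A + const_mx c.
  rewrite mulmxDr mulmx1 mulmxA [(A + _) *m j]mulmxDl Aj add0r -(mulmxA j) dj.
  rewrite mulmx1 -addrA -mulmxDr subrKC; congr (_ + _).
  by apply/matrixP=> a b; rewrite !mxE big_ord1 !mxE mul1r mulr1.
rewrite -to_const -to_col -to_row !det_mulmx !det_add1_outer cofactorE_det.
rewrite !mulmxBl !mulmxBr -scalemxAl dd dj jd jj !mxE eqxx subrr addr0 mul1r.
by rewrite !mulr1n !subrKC mulrC mulrA expr2 !mulrA.
Qed.

End WeightedLaplacian.

Section GraphLaplacian.
Variables (R : comNzRingType) (G : sgraph) (n : nat) (e : 'I_n -> G).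

Definition adjacency_mx : 'M[R]_n := \matrix_(i, j) (sedge (e i) (e j))%:R.

Definition laplacian := laplacian_mx adjacency_mx.

Lemma adjacency_mx_tr : adjacency_mx^T = adjacency_mx.
Proof. by apply/matrixP=> i j; rewrite !mxE sedge_sym. Qed.

Hypothesis e_bij : bijective e.

Theorem matrix_tree r : cofactor laplacian r r = (tau G)%:R.
Proof.
rewrite weighted_matrix_tree (natr_tau _ (e r)).
rewrite (reindex_rooted _ (fun x y => (sedge x y)%:R) e_bij).
by apply: eq_bigr => f _; apply: eq_bigr => v _; rewrite mxE.
Qed.

Lemma mxtrace_laplacian : \tr laplacian = (2 * #|edges G|)%:R.
Proof.
rewrite -handshake natr_sum [RHS](reindex e) /=; last exact: onW_bij.
apply: eq_bigr => i _; rewrite natr_sum (reindex e) /=; last exact: onW_bij.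
rewrite !mxE eqxx mul1r sedge_irrefl subr0.
by apply: eq_bigr => j _; rewrite mxE.
Qed.

End GraphLaplacian.

(** * Laplacian spectra *)

Lemma ord_gt0 n : 'I_n -> (0 < n)%N.
Proof. by case: n => [[]|]. Qed.

Section QuadraticForm.
Variables (C : numClosedFieldType) (n : nat) (w : 'M[C]_n).
Hypothesis w_sym : w^T = w.

Lemma laplacian_mx_quadratic_form (x : 'rV_n) :
  dotmx (x *m laplacian_mx w) x *+ 2 =
  \sum_i \sum_j w i j * `|x 0 i - x 0 j| ^+ 2.
Proof.
have formE : dotmx (x *m laplacian_mx w) x =
    \sum_i \sum_j w i j * (x 0 i - x 0 j) * (x 0 i)^*.
  rewrite dotmxE mul_row_laplacian_mx // mxE; apply: eq_bigr => i _.
  by rewrite !mxE mulr_suml.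
rewrite mulr2n {1}formE formE [X in _ + X]exchange_big -big_split /=.
apply: eq_bigr => i _; rewrite -big_split /=; apply: eq_bigr => j _.
have -> : w j i = w i j by rewrite -[in LHS]w_sym mxE.
rewrite normCK rmorphB /= -!mulrA -mulrDr -[x 0 j - x 0 i]opprB mulNr.
by rewrite -mulrBr.
Qed.

Lemma laplacian_mx_eigenvalue_ge0 a :
  (forall i j, 0 <= w i j) -> eigenvalue (laplacian_mx w) a -> 0 <= a.
Proof.
move=> w_ge0 /eigenvalueP[x xL x_neq0].
have x_gt0 : 0 < dotmx x x by rewrite dnorm_gt0.
rewrite -(pmulr_lge0 _ x_gt0) -(pmulrn_lge0 _ (isT : 0 < 2)%N).
rewrite -linearZl_LR /= -xL laplacian_mx_quadratic_form.
by do 2!apply: sumr_ge0 => ? _; rewrite mulr_ge0 ?exprn_ge0.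
Qed.

End QuadraticForm.

Lemma realsym_diagonalizable (C : numClosedFieldType) n (A : 'M[C]_n) :
  A^T = A -> A \is a mxOver Num.real -> diagonalizable A.
Proof.
move=> A_sym A_real.
have /symmetric_normalmx/(_ A_real)/orthomx_spectralP AE : A \is symmetricmx.
  by apply/is_hermitianmxP; rewrite expr0 scale1r map_mx_id.
have Pu := spectral_unit A; exists (spectralmx A) => //.
apply/similar_diagPex; exists (spectral_diag A); apply/(similarRL Pu).
by rewrite {3}AE !mulmxA mulmxV // mul1mx mulmxK.
Qed.

Lemma diag_mx_delta (R : pzSemiRingType) n (i : 'I_n) :
  diag_mx (delta_mx 0 i) = delta_mx i i :> 'M[R]_n.
Proof.
apply/matrixP=> j k; rewrite !mxE eqxx /=; have [<-|jk] := eqVneq j k.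
  by rewrite mulr1n andbb.
by case: eqVneq => // ji; rewrite mulr0n -ji eq_sym (negPf jk).
Qed.

Lemma idempotent_diag_mx (R : numDomainType) n (v : 'rV[R]_n) :
    diag_mx v *m diag_mx v = diag_mx v -> \tr (diag_mx v) = 1 ->
  exists i, v = delta_mx 0 i.
Proof.
move=> v_idem; rewrite mxtrace_diag => v_tr.
have vE i : v 0 i = (v 0 i != 0)%:R.
  have [//|v_neq0] := eqVneq (v 0 i) 0; apply: (mulfI v_neq0); rewrite mulr1.
  by have /matrixP/(_ i i) := v_idem; rewrite mulmx_diag !mxE eqxx.
have /card1P[i0 i0P] : #|[pred i | v 0 i != 0]| == 1%N.
  rewrite -(eqr_nat R); apply/eqP; rewrite -[RHS]v_tr -sum1_card natr_sum.
  by rewrite big_mkcond; apply: eq_bigr => i _; rewrite [RHS]vE inE; case: ifP.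
exists i0; apply/rowP=> i; rewrite !mxE vE.
by have := i0P i; rewrite !inE => ->.
Qed.

Section Spectrum.
Variable C : numClosedFieldType.

(* The orthogonal projection onto the constant vectors. *)
Definition mean_mx n : 'M[C]_n := const_mx n%:R^-1.

Lemma mean_mx_idem n : (0 < n)%N -> mean_mx n *m mean_mx n = mean_mx n.
Proof.
move=> n_gt0; apply/matrixP=> i j; rewrite !mxE.
under eq_bigr do rewrite !mxE.
rewrite sumr_const card_ord -[LHS]mulr_natl mulrA.
by rewrite mulfV ?mul1r // pnatr_eq0 -lt0n.
Qed.

Lemma mxtrace_mean_mx n : (0 < n)%N -> \tr (mean_mx n) = 1.
Proof.
move=> n_gt0; rewrite /mxtrace; under eq_bigr do rewrite mxE.
by rewrite sumr_const card_ord -[LHS]mulr_natl mulfV // pnatr_eq0 -lt0n.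
Qed.

(* [l] lists the eigenvalues of [A] in a basis containing a constant vector, at
   position [i0], and otherwise consisting of zero-sum vectors. *)
Definition laplacian_spectrum n (A : 'M[C]_n) (l : 'rV[C]_n) (i0 : 'I_n) :=
  exists2 P : 'M[C]_n, P \in unitmx &
    [/\ P *m A = diag_mx l *m P, P *m mean_mx n = delta_mx i0 i0 *m P
      & l 0 i0 = 0].

Lemma exists_laplacian_spectrum n (A : 'M[C]_n) : (0 < n)%N ->
    A^T = A -> A \is a mxOver Num.real -> A *m mean_mx n = 0 ->
  exists l i0, laplacian_spectrum A l i0.
Proof.
move=> n_gt0 A_sym A_real AJ; pose J := mean_mx n.
have J_sym : J^T = J by rewrite trmx_const.
have JA : J *m A = 0 by apply: trmx_inj; rewrite trmx_mul A_sym J_sym AJ trmx0.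
have [P Pu] : codiagonalizable [:: A; J].
  apply/codiagonalizableP; split=> [B B'|B].
    by rewrite !inE => /orP[]/eqP-> /orP[]/eqP->; rewrite /comm_mx ?AJ ?JA.
  rewrite !inE => /orP[]/eqP->; apply: realsym_diagonalizable => //.
  by apply/mxOver_const; rewrite rpredV realn.
rewrite /= andbT => /andP[/similar_diagPex[l Pl] /similar_diagPex[v Pv]].
have [PA vE] := (elimT (similarP Pu) Pl, elimT (similarRL Pu) Pv).
have [||i0 vi0] := @idempotent_diag_mx _ _ v.
- by rewrite vE !mulmxA mulmxKV // -(mulmxA P) mean_mx_idem.
- by rewrite vE mxtrace_mulC mulKmx // mxtrace_mean_mx.
exists l, i0, P => //; split=> //.
  by rewrite -diag_mx_delta -vi0; apply/(similarP Pu).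
have : diag_mx l *m delta_mx i0 i0 = 0.
  by rewrite -diag_mx_delta -vi0 vE !mulmxA -PA -(mulmxA P) AJ mulmx0 mul0mx.
by move/matrixP/(_ i0 i0); rewrite mul_diag_mx !mxE eqxx mulr1.
Qed.

Section SpectrumTheory.
Variables (n : nat) (A : 'M[C]_n) (l : 'rV[C]_n) (i0 : 'I_n).
Hypothesis l_spectrum : laplacian_spectrum A l i0.

Lemma laplacian_spectrum_det :
  \det (A + mean_mx n) = \prod_(i | i != i0) l 0 i.
Proof.
have [P Pu [PA PJ l0]] := l_spectrum.
have -> : A + mean_mx n = invmx P *m diag_mx (l + delta_mx 0 i0) *m P.
  rewrite linearD /= -mulmxA mulmxDl -PA.
  by rewrite diag_mx_delta -PJ -mulmxDr mulKmx.
rewrite !det_mulmx mulrAC -det_mulmx mulVmx // det1 mul1r det_diag.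
rewrite (bigD1 i0) //= !mxE l0 !eqxx add0r mul1r.
apply: eq_bigr => i /negPf ii0; by rewrite !mxE ii0 andbF addr0.
Qed.

Lemma laplacian_spectrum_trace : \tr A = \sum_(i | i != i0) l 0 i.
Proof.
have [P Pu [PA _ l0]] := l_spectrum.
rewrite -[A](mulKmx Pu) PA mxtrace_mulC mulmxK // mxtrace_diag.
by rewrite (bigD1 i0) //= l0 add0r.
Qed.

Lemma laplacian_spectrum_eigenvalue i : eigenvalue A (l 0 i).
Proof.
have [P Pu [PA _ _]] := l_spectrum; apply/eigenvalueP; exists (row i P).
  by rewrite -row_mul PA row_mul row_diag_mx -scalemxAl -rowE.
apply: contraTneq isT => Pi0.
have : row i P *m invmx P = 0 by rewrite Pi0 mul0mx.
rewrite -row_mul mulmxV // => /rowP/(_ i); rewrite !mxE eqxx => /eqP.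
by rewrite oner_eq0.
Qed.

Lemma laplacian_spectrum_constP c :
  (forall i, i != i0 -> l 0 i = c) <-> A = c *: (1%:M - mean_mx n).
Proof.
have [P Pu [PA PJ l0]] := l_spectrum.
have PcJ : P *m (c *: (1%:M - mean_mx n)) = c *: (1%:M - delta_mx i0 i0) *m P.
  by rewrite -scalemxAr -scalemxAl mulmxBr mulmxBl PJ mulmx1 mul1mx.
split=> [lc|AE i /negPf ii0].
  apply: (can_inj (mulKmx Pu)); rewrite PA PcJ; congr (_ *m P).
  apply/matrixP=> i j; rewrite !mxE; have [<-|ij] := eqVneq i j; last first.
    by case: eqVneq => [<-|_]; rewrite ?(eq_sym j) ?(negPf ij) subr0 mulr0.
  by have [->|/lc ->] := eqVneq i i0; rewrite ?l0 ?subrr ?subr0 ?mulr0 ?mulr1.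
have lE : diag_mx l = c *: (1%:M - delta_mx i0 i0).
  by apply: (can_inj (mulmxK Pu)); rewrite -PA AE PcJ.
by have /matrixP/(_ i i) := lE; rewrite !mxE eqxx ii0 subr0 mulr1.
Qed.

End SpectrumTheory.

End Spectrum.

(** * Cartesian products *)

Lemma cardC1_ord n (i : 'I_n) : #|predC1 i| = (n - 1)%N.
Proof. by rewrite cardC1 card_ord subn1. Qed.

Lemma big_mxtens (T : Type) (idx : T) (op : Monoid.com_law idx) m n
    (P : pred 'I_(m * n)) (F : 'I_(m * n) -> T) :
  \big[op/idx]_(k | P k) F k =
  \big[op/idx]_(p | P (mxtens_index p)) F (mxtens_index p).
Proof.
by apply: reindex; exists (@mxtens_unindex m n) => k _;
  rewrite (mxtens_indexK, mxtens_unindexK).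
Qed.

Lemma big_pairC1 (T : Type) (idx : T) (op : Monoid.com_law idx) (I J : finType)
    (i0 : I) (j0 : J) (F : I -> J -> T) :
  \big[op/idx]_(p | p != (i0, j0)) F p.1 p.2 =
  op (op (\big[op/idx]_(i | i != i0) F i j0)
         (\big[op/idx]_(j | j != j0) F i0 j))
     (\big[op/idx]_(p | (p.1 != i0) && (p.2 != j0)) F p.1 p.2).
Proof.
rewrite (bigID (fun p => p.1 == i0)) /= Monoid.mulmC.
rewrite (bigID (fun p => p.2 == j0)) /= Monoid.mulmAC; congr (op (op _ _) _).
- rewrite (eq_bigl (fun p => (p.1 != i0) && (p.2 == j0))); last first.
    by case=> i j; rewrite xpair_eqE /=; case: eqP; case: eqP.
  rewrite -(pair_big (fun i => i != i0) (pred1 j0) F) /=.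
  by apply: eq_bigr => i _; rewrite big_pred1_eq.
- rewrite (eq_bigl (fun p => (p.1 == i0) && (p.2 != j0))); last first.
    by case=> i j; rewrite xpair_eqE /=; case: eqP; case: eqP.
  rewrite -(pair_big (pred1 i0) (fun j => j != j0) F) /=.
  by rewrite big_pred1_eq.
- by apply: eq_bigl => -[i j]; rewrite xpair_eqE /=; case: eqP; case: eqP.
Qed.

Section Tensor.
Variable R : comNzRingType.

Definition kronecker_sum m n (A : 'M[R]_m) (B : 'M[R]_n) : 'M[R]_(m * n) :=
  A *t 1%:M + 1%:M *t B.

Lemma kronecker_sumE m n (A : 'M[R]_m) (B : 'M[R]_n) i j k l :
  kronecker_sum A B (mxtens_index (i, j)) (mxtens_index (k, l)) =
  A i k * (j == l)%:R + (i == k)%:R * B j l.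
Proof. by rewrite mxE !tensmxE !mxE. Qed.

Lemma tens_delta_mx m n (i k : 'I_m) (j l : 'I_n) :
  delta_mx i k *t delta_mx j l =
    delta_mx (mxtens_index (i, j)) (mxtens_index (k, l)) :> 'M[R]_(m * n).
Proof.
apply/matrixP=> a b; case: (mxtens_indexP a) => a1 a2.
case: (mxtens_indexP b) => b1 b2; rewrite tensmxE !mxE -natrM mulnb.
by rewrite !(can_eq (@mxtens_indexK _ _)) !xpair_eqE andbACA.
Qed.

Definition row_pair_sums m n (u : 'rV[R]_m) (v : 'rV[R]_n) : 'rV[R]_(m * n) :=
  \row_k (u 0 (mxtens_unindex k).1 + v 0 (mxtens_unindex k).2).

Lemma row_pair_sumsE m n (u : 'rV[R]_m) (v : 'rV[R]_n) p :
  row_pair_sums u v 0 (mxtens_index p) = u 0 p.1 + v 0 p.2.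
Proof. by rewrite mxE mxtens_indexK. Qed.

Lemma kronecker_sum_diag_mx m n (u : 'rV[R]_m) (v : 'rV[R]_n) :
  kronecker_sum (diag_mx u) (diag_mx v) = diag_mx (row_pair_sums u v).
Proof.
apply/matrixP=> a b; case: (mxtens_indexP a) => i j.
case: (mxtens_indexP b) => k l; rewrite kronecker_sumE !mxE.
rewrite (can_eq (@mxtens_indexK _ _)) xpair_eqE mxtens_indexK /=.
by case: eqP; case: eqP; rewrite ?(mulr1, mul1r, mulr0, mul0r, addr0).
Qed.

Lemma laplacian_mx_kronecker_sum m n (A : 'M[R]_m) (B : 'M[R]_n) :
  laplacian_mx (kronecker_sum A B) =
  kronecker_sum (laplacian_mx A) (laplacian_mx B).
Proof.
apply/matrixP=> a b; case: (mxtens_indexP a) => i j.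
case: (mxtens_indexP b) => k l; rewrite kronecker_sumE mxE kronecker_sumE !mxE.
have -> : \sum_p kronecker_sum A B (mxtens_index (i, j)) p =
    \sum_k A i k + \sum_l B j l.
  pose F p q := A i p * (j == q)%:R + (i == p)%:R * B j q.
  rewrite big_mxtens (eq_bigr (fun pq => F pq.1 pq.2)); last first.
    by case=> p q _; apply: kronecker_sumE.
  rewrite -(pair_bigA _ F) /F /=.
  under eq_bigr do rewrite big_split /= -!mulr_sumr.
  by rewrite big_split /= -!mulr_suml !sumr_delta mulr1 mul1r.
rewrite (can_eq (@mxtens_indexK _ _)) xpair_eqE -mulnb natrM mulrDr mulrBl.
rewrite mulrBr opprD addrACA.
by congr (_ - _ + (_ - _)); rewrite ?mulrA // mulrAC.
Qed.

End Tensor.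

Lemma laplacian_spectrum_kronecker_sum (C : numClosedFieldType) m n
    (A : 'M[C]_m) (B : 'M[C]_n) u v i j :
    laplacian_spectrum A u i -> laplacian_spectrum B v j ->
  laplacian_spectrum (kronecker_sum A B) (row_pair_sums u v)
    (mxtens_index (i, j)).
Proof.
move=> [P Pu [PA PJ ui]] [Q Qu [QB QJ vj]]; exists (P *t Q).
  by apply: tensmx_unit; rewrite // -lt0n (ord_gt0 i, ord_gt0 j).
split; last by rewrite row_pair_sumsE ui vj addr0.
- rewrite -kronecker_sum_diag_mx mulmxDr mulmxDl !tensmx_mul PA QB.
  by rewrite !mulmx1 !mul1mx.
- have -> : mean_mx C (m * n) = mean_mx C m *t mean_mx C n.
    by apply/matrixP=> a b; rewrite !mxE natrM invfM.
  by rewrite tensmx_mul PJ QJ -tens_delta_mx tensmx_mul.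
Qed.

Section CartesianProduct.
Variables (G1 G2 : sgraph) (n1 n2 : nat) (e1 : 'I_n1 -> G1) (e2 : 'I_n2 -> G2).
Hypotheses (e1_bij : bijective e1) (e2_bij : bijective e2).

Definition cart_enum (k : 'I_(n1 * n2)) : cart_prod G1 G2 :=
  (e1 (mxtens_unindex k).1, e2 (mxtens_unindex k).2).

Lemma cart_enum_bij : bijective cart_enum.
Proof.
have [f1 e1K f1K] := e1_bij; have [f2 e2K f2K] := e2_bij.
exists (fun x : cart_prod G1 G2 => mxtens_index (f1 x.1, f2 x.2)) => [k|[x y]].
  by rewrite /cart_enum /= e1K e2K -[RHS]mxtens_unindexK.
by rewrite /cart_enum mxtens_indexK /= f1K f2K.
Qed.

Lemma laplacian_cart_prod (R : comNzRingType) :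
  laplacian R cart_enum = kronecker_sum (laplacian R e1) (laplacian R e2).
Proof.
rewrite -laplacian_mx_kronecker_sum; congr laplacian_mx.
apply/matrixP=> a b; case: (mxtens_indexP a) => i j.
case: (mxtens_indexP b) => k l; rewrite kronecker_sumE !mxE /cart_enum.
rewrite !mxtens_indexK -[sedge _ _]/(cart_rel (e1 i, e2 j) (e1 k, e2 l)).
rewrite /cart_rel /= (bij_eq e1_bij) (bij_eq e2_bij).
have [->|_] := eqVneq i k; have [->|_] := eqVneq j l;
  by rewrite ?sedge_irrefl /= ?(mul0r, mul1r, mulr0, mulr1, add0r, addr0, orbF).
Qed.

End CartesianProduct.

Section GraphSpectrum.
Variables (C : numClosedFieldType) (G : sgraph) (n : nat) (e : 'I_n -> G).

Lemma exists_graph_spectrum : (0 < n)%N ->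
  exists l i0, laplacian_spectrum (laplacian C e) l i0.
Proof.
move=> n_gt0; apply: exists_laplacian_spectrum => //.
- exact/laplacian_mx_tr/adjacency_mx_tr.
- apply/mxOverP=> i j; rewrite !mxE rpredB ?rpredM ?realn // rpred_sum //.
  by move=> k _; rewrite mxE realn.
- exact: laplacian_mx_const.
Qed.

Variables (l : 'rV[C]_n) (i0 : 'I_n).
Hypothesis l_spectrum : laplacian_spectrum (laplacian C e) l i0.

Lemma graph_spectrum_ge0 i : 0 <= l 0 i.
Proof.
apply: laplacian_mx_eigenvalue_ge0 (laplacian_spectrum_eigenvalue l_spectrum i).
  exact: adjacency_mx_tr.
by move=> j k; rewrite mxE.
Qed.

Hypothesis e_bij : bijective e.

Lemma tau_spectrum : n%:R * (tau G)%:R = \prod_(i | i != i0) l 0 i.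
Proof.
rewrite -(laplacian_spectrum_det l_spectrum) (det_add_const_mx _ i0).
- rewrite matrix_tree // expr2 mulrA mulVf ?mul1r //.
  by rewrite pnatr_eq0 -lt0n (ord_gt0 i0).
- exact: laplacian_mx_const.
- exact/const_laplacian_mx/adjacency_mx_tr.
Qed.

Lemma mean_spectrum :
  (\sum_(i in predC1 i0) l 0 i) / #|predC1 i0|%:R =
  2 * #|edges G|%:R / (n%:R - 1).
Proof.
rewrite -(laplacian_spectrum_trace l_spectrum) mxtrace_laplacian // natrM.
by rewrite cardC1_ord natrB // (ord_gt0 i0).
Qed.

End GraphSpectrum.

Lemma tau_cart_prod (C : numClosedFieldType) (G1 G2 : sgraph) (n1 n2 : nat)
    (e1 : 'I_n1 -> G1) (e2 : 'I_n2 -> G2) l1 i1 l2 i2 :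
    bijective e1 -> bijective e2 ->
    laplacian_spectrum (laplacian C e1) l1 i1 ->
    laplacian_spectrum (laplacian C e2) l2 i2 ->
  (tau (cart_prod G1 G2))%:R = (tau G1)%:R * (tau G2)%:R *
    \prod_(p | (p.1 != i1) && (p.2 != i2)) (l1 0 p.1 + l2 0 p.2).
Proof.
move=> e1_bij e2_bij sp1 sp2.
have n_neq0 n (i : 'I_n) : n%:R != 0 :> C.
  by rewrite pnatr_eq0 -lt0n (ord_gt0 i).
apply: (mulfI (mulf_neq0 (n_neq0 _ i1) (n_neq0 _ i2))).
have sp := laplacian_spectrum_kronecker_sum sp1 sp2.
rewrite -laplacian_cart_prod // in sp.
rewrite -[n1%:R * n2%:R]natrM (tau_spectrum sp (cart_enum_bij e1_bij e2_bij)).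
rewrite natrM mulrA [n1%:R * _ * _]mulrACA.
rewrite (tau_spectrum sp1 e1_bij) (tau_spectrum sp2 e2_bij).
have [[_ _ [_ _ l10]] [_ _ [_ _ l20]]] := (sp1, sp2).
rewrite big_mxtens (eq_bigl (fun p => p != (i1, i2))) => [|p]; last first.
  by rewrite (can_eq (@mxtens_indexK _ _)).
under eq_bigr do rewrite row_pair_sumsE.
rewrite (big_pairC1 _ _ _ (fun i j => l1 0 i + l2 0 j)) /=; congr (_ * _ * _).
  by apply: eq_bigr => i _; rewrite l20 addr0.
by apply: eq_bigr => j _; rewrite l10 add0r.
Qed.

(** * The bound *)

Section ConstantOn.
Variables (I : finType) (T : eqType).
Implicit Types (A : {pred I}) (x : I -> T).

Definition constant_on A x := [forall i in A, forall j in A, x i == x j].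

Lemma constant_onP A x :
  reflect {in A &, forall i j, x i = x j} (constant_on A x).
Proof.
apply: (iffP 'forall_in_'forall_in_eqP) => x_const i.
  by move=> j Ai; apply: x_const.
by move=> Ai j; apply: x_const.
Qed.

End ConstantOn.

Section AGM.
Variables (I J : finType) (A : {pred I}) (B : {pred J}).
Hypotheses (A_gt0 : (0 < #|A|)%N) (B_gt0 : (0 < #|B|)%N).

Lemma constant_on_add (V : zmodType) (x : I -> V) (y : J -> V) :
  constant_on [predX A & B] (fun p => x p.1 + y p.2) =
  constant_on A x && constant_on B y.
Proof.
have [[i0 Ai0] [j0 Bj0]] := (card_gt0P A_gt0, card_gt0P B_gt0).
apply/constant_onP/andP => [xy_const|[/constant_onP xC /constant_onP yC]].
  split; apply/constant_onP=> k k' Ak Ak'.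
    by apply: (@addIr _ (y j0)); apply: (xy_const (k, j0) (k', j0));
      rewrite inE /= ?Ak ?Ak'.
  by apply: (@addrI _ (x i0)); apply: (xy_const (i0, k) (i0, k'));
    rewrite inE /= Ai0.
move=> [i j] [i' j'] /andP[/= Ai Bj] /andP[/= Ai' Bj'].
by rewrite (xC i i') // (yC j j').
Qed.

Lemma leif_AGM_add (R : numFieldType) (x : I -> R) (y : J -> R) :
    {in A, forall i, 0 <= x i} -> {in B, forall j, 0 <= y j} ->
  \prod_(p | (p.1 \in A) && (p.2 \in B)) (x p.1 + y p.2) <=
    ((\sum_(i in A) x i) / #|A|%:R + (\sum_(j in B) y j) / #|B|%:R)
      ^+ (#|A| * #|B|)
  ?= iff constant_on A x && constant_on B y.
Proof.
move=> x_ge0 y_ge0; pose E p := x p.1 + y p.2.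
have E_ge0 : {in [predX A & B], forall p, 0 <= E p}.
  by move=> [i j] /andP[/x_ge0 xi /y_ge0 yj]; apply: addr_ge0.
have meanE : (\sum_(p in [predX A & B]) E p) / #|[predX A & B]|%:R =
    (\sum_(i in A) x i) / #|A|%:R + (\sum_(j in B) y j) / #|B|%:R.
  have [A_neq0 B_neq0] : #|A|%:R != 0 :> R /\ #|B|%:R != 0 :> R.
    by rewrite !pnatr_eq0 -!lt0n.
  rewrite cardX natrM -(pair_big (mem A) (mem B) (fun i j => x i + y j)) /=.
  under eq_bigr do rewrite big_split /= sumr_const.
  rewrite big_split /= sumr_const sumrMnl -[_ *+ #|B|]mulr_natr.
  rewrite -[_ *+ #|A|]mulr_natr mulrDl invfM [X in X + _]mulrACA divff // mulr1.
  by rewrite [_^-1 * _^-1]mulrC mulrACA divff // mulr1.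
have := leif_AGM E_ge0; rewrite meanE cardX -/(constant_on _ _).
by rewrite constant_on_add.
Qed.

End AGM.

Definition complete (G : sgraph) : bool :=
  [forall x : G, forall y : G, (x != y) ==> sedge x y].

Lemma completeP (G : sgraph) :
  reflect (forall x y : G, x != y -> sedge x y) (complete G).
Proof.
by apply: (iffP 'forall_'forall_implyP) => Gc x; [move=> y|]; apply: Gc.
Qed.

Lemma sg_iso_complete_graph (G : sgraph) :
  sg_iso G (complete_graph #|G|) <-> complete G.
Proof.
split=> [[f /bij_inj f_inj fE]|/completeP Gc].
  by apply/completeP=> x y xy; rewrite -fE /= /complete_rel /= (inj_eq f_inj).
exists enum_rank => [|x y]; first exact: enum_rank_bij.
rewrite /= /complete_rel /= (inj_eq enum_rank_inj).
by have [->|/Gc ->] := eqVneq x y; rewrite ?sedge_irrefl.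
Qed.

Section CompleteLaplacian.
Variables (C : numClosedFieldType) (G : sgraph) (n : nat) (e : 'I_n -> G).
Hypothesis e_bij : bijective e.

Lemma laplacian_complete :
  complete G -> laplacian C e = n%:R *: (1%:M - mean_mx C n).
Proof.
move/completeP=> Gc; have e_inj := bij_inj e_bij.
have adjE i j : (sedge (e i) (e j))%:R = 1 - (i == j)%:R :> C.
  have [->|ij] := eqVneq i j; first by rewrite sedge_irrefl subrr.
  by rewrite Gc ?(inj_eq e_inj) // subr0.
apply/matrixP=> i j; have n_neq0 : n%:R != 0 :> C.
  by rewrite pnatr_eq0 -lt0n (ord_gt0 i).
rewrite !mxE adjE !mulrBr mulfV //; under eq_bigr do rewrite mxE adjE.
rewrite sumrB sumr_const card_ord sumr_delta mulrBr mulr1 opprB addrA subrK.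
by rewrite mulrC mulr_natr.
Qed.

Lemma laplacian_scaled_complete c :
  c != 0 -> laplacian C e = c *: (1%:M - mean_mx C n) -> complete G.
Proof.
have [e' eK e'K] := e_bij.
move=> c_neq0 /matrixP LE; apply/completeP=> x y.
rewrite -[x]e'K -[y]e'K (inj_eq (can_inj eK)) => /negPf xy.
have := LE (e' x) (e' y); rewrite !mxE xy mul0r !sub0r mulrN => /oppr_inj.
case: sedge => // /eqP; rewrite eq_sym mulf_eq0 invr_eq0 (negPf c_neq0).
by rewrite pnatr_eq0 eqn0Ngt (ord_gt0 (e' x)).
Qed.

Lemma spectrum_const_complete (l : 'rV[C]_n) i0 :
    laplacian_spectrum (laplacian C e) l i0 -> connected G -> (1 < n)%N ->
  constant_on (predC1 i0) (l 0) = complete G.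
Proof.
move=> sp Gc n_gt1; have lE := laplacian_spectrum_constP sp.
apply/constant_onP/idP => [l_const|/laplacian_complete/lE l_n]; last first.
  by move=> i j ii0 ji0; rewrite !l_n.
have [k ki0] : exists k, k \in predC1 i0.
  by apply/card_gt0P; rewrite cardC1_ord subn_gt0.
apply: (laplacian_scaled_complete (c := l 0 k)); last first.
  by apply/lE=> i ii0; apply: l_const.
have tauG_gt0 : (0 < tau G)%N.
  by rewrite tau_gt0 //; apply/card_gt0P; exists (e i0).
have : n%:R * (tau G)%:R != 0 :> C.
  by rewrite -natrM pnatr_eq0 muln_eq0 negb_or -!lt0n (ord_gt0 i0).
rewrite (tau_spectrum sp e_bij); apply: contraNneq => lk0.
by rewrite (bigD1 k) //= lk0 mul0r.
Qed.

End CompleteLaplacian.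

Lemma tau_cart_prod_leif (C : numClosedFieldType) (G1 G2 : sgraph) :
    (1 < #|G1|)%N -> (1 < #|G2|)%N ->
  (tau (cart_prod G1 G2))%:R <= (tau G1)%:R * (tau G2)%:R *
    (2 * #|edges G1|%:R / (#|G1|%:R - 1) + 2 * #|edges G2|%:R / (#|G2|%:R - 1))
      ^+ ((#|G1| - 1) * (#|G2| - 1))
  ?= iff [|| ~~ connected G1, ~~ connected G2 | complete G1 && complete G2]
    :> C.
Proof.
move=> n1_gt1 n2_gt1.
have [e1_bij e2_bij] := (@enum_val_bij G1, @enum_val_bij G2).
have [l1 [i1 sp1]] := exists_graph_spectrum C (@enum_val G1 G1) (ltnW n1_gt1).
have [l2 [i2 sp2]] := exists_graph_spectrum C (@enum_val G2 G2) (ltnW n2_gt1).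
rewrite (tau_cart_prod e1_bij e2_bij sp1 sp2).
have [conn1E conn2E] := (tau_gt0 (ltnW n1_gt1), tau_gt0 (ltnW n2_gt1)).
have [t0|t_neq0] := eqVneq ((tau G1)%:R * (tau G2)%:R : C) 0.
  rewrite t0 !mul0r; apply/leifP; move/eqP: t0.
  by rewrite mulf_eq0 !pnatr_eq0 !eqn0Ngt conn1E conn2E orbA eqxx => ->.
have [conn1 conn2] : connected G1 /\ connected G2.
  by apply/andP; rewrite -conn1E -conn2E -muln_gt0 lt0n -(pnatr_eq0 C) natrM.
rewrite conn1 conn2 /= mono_leif => [|x y]; last first.
  by rewrite ler_pM2l // lt_def t_neq0 mulr_ge0.
rewrite -(spectrum_const_complete e1_bij sp1) //.
rewrite -(spectrum_const_complete e2_bij sp2) //.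
rewrite -(mean_spectrum sp1 e1_bij) -(mean_spectrum sp2 e2_bij).
rewrite -(cardC1_ord i1) -(cardC1_ord i2); apply: leif_AGM_add.
- by rewrite cardC1_ord subn_gt0.
- by rewrite cardC1_ord subn_gt0.
- by move=> i _; apply: graph_spectrum_ge0 sp1 i.
- by move=> i _; apply: graph_spectrum_ge0 sp2 i.
Qed.

Lemma leif_rat (F : numFieldType) (x y : rat) b :
  (ratr x <= ratr y ?= iff b :> F) = (x <= y ?= iff b).
Proof. by rewrite /Order.leif ler_rat (inj_eq (fmorph_inj _)). Qed.

Theorem theorem2 (G1 G2 : sgraph) (n1 n2 m1 m2 : nat)
    (hn1 : n1 = #|G1|) (hn2 : n2 = #|G2|)
    (hm1 : m1 = #|edges G1|) (hm2 : m2 = #|edges G2|)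
    (n1_ge2 : (2 <= n1)%N) (n2_ge2 : (2 <= n2)%N) :
  let lhs : rat := (tau (cart_prod G1 G2))%:R in
  let rhs : rat := (tau G1)%:R * (tau G2)%:R *
    (2 * m1%:R / (n1%:R - 1) + 2 * m2%:R / (n2%:R - 1))
      ^+ ((n1 - 1) * (n2 - 1)) in
  lhs <= rhs /\
  (lhs = rhs <->
     [\/ ~ connected G1, ~ connected G2
       | sg_iso G1 (complete_graph n1) /\ sg_iso G2 (complete_graph n2)]).
Proof.
move=> lhs rhs.
have [lhs_le lhs_eq] : lhs <= rhs
    ?= iff [|| ~~ connected G1, ~~ connected G2 | complete G1 && complete G2].
  rewrite -(leif_rat algC) /lhs /rhs.
  rewrite !(rmorphM, rmorphXn) rmorphD !fmorph_div !rmorphM !rmorphB /=.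
  rewrite !ratr_nat rmorph1; move: n1_ge2 n2_ge2; rewrite hm1 hm2 hn1 hn2.
  exact: tau_cart_prod_leif.
have [iso1 iso2] := (sg_iso_complete_graph G1, sg_iso_complete_graph G2).
split=> //; rewrite hn1 hn2; split=> [/eqP|].
  rewrite lhs_eq => /or3P[/negP|/negP|/andP[/iso1 ? /iso2 ?]].
  - exact: Or31.
  - exact: Or32.
  - exact: Or33.
move=> cond; apply/eqP; rewrite lhs_eq.
by case: cond => [/negP->|/negP->|[/iso1-> /iso2->]]; rewrite ?orbT.
Qed.
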